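(* Let $\mathcal{N}_i$ be a finite nonempty set (the neighbors of node $i$) with $N_i = |\mathcal{N}_i|$, and let $P_{j,i} \in (0,1]$ for each $j \in \mathcal{N}_i$. Let $\bar{T}_i$ be the expected time that node $i$ takes to discover all its $N_i$ neighbors, given by $$\bar{T}_i = \sum_{\emptyset \neq S \subseteq \mathcal{N}_i} (-1)^{|S|+1} \frac{1}{\sum_{j \in S} P_{j,i}}.$$ Then $$\bar{T}_i \geq \frac{\mathrm{H}_{N_i}}{\bar{P}_i}, \qquad \text{where } \bar{P}_i = \frac{1}{N_i} \sum_{j \in \mathcal{N}_i} P_{j,i}$$ and $\mathrm{H}_{N_i} = \sum_{m=1}^{N_i} \frac{1}{m}$ is the $N_i$-th harmonic number.
   Context: In random one-way neighbor discovery, $P_{j,i}$ is the probability that node $i$ discovers its neighbor $j$ in a time instant. The expected time $\bar{T}_i$ for node $i$ to discover all its neighbors is taken to be given by the inclusion-exclusion formula in the claim, i.e. $\sum_j \frac{1}{P_{j,i}} - \sum_{\{j,k\}} \frac{1}{P_{j,i}+P_{k,i}} + \dots + (-1)^{N_i+1} \frac{1}{\sum_{j} P_{j,i}}$, with the sums running over unordered subsets of $\mathcal{N}_i$. *)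

(* Defs.v *)
From mathcomp Require Import all_boot all_order all_algebra.

Set Implicit Arguments.
Unset Strict Implicit.
Unset Printing Implicit Defensive.

Import Order.TTheory GRing.Theory Num.Theory.
Local Open Scope ring_scope.

(* [P j i] is the probability that node [i] discovers its neighbor [j] in a
   time instant; [N] is the set of neighbors of [i].  The expected time for [i]
   to discover all of [N] is, by definition, the inclusion-exclusion sum over
   the nonempty subsets of [N]. *)
Definition expected_discovery_time (R : realFieldType) (V : finType)
    (P : V -> V -> R) (i : V) (N : {set V}) : R :=
  \sum_(S : {set V} | (S != set0) && (S \subset N))
    (-1) ^+ (#|S|.+1) * (1 / \sum_(j in S) P j i).

Definition mean_discovery_prob (R : realFieldType) (V : finType)
    (P : V -> V -> R) (i : V) (N : {set V}) : R :=
  1 / #|N|%:R * \sum_(j in N) P j i.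

Definition harmonic_number (R : realFieldType) (n : nat) : R :=
  \sum_(1 <= m < n.+1) 1 / m%:R.

(* Main.v *)
(* Write [p j = P j i] and [sigma(S)] for the sum of [p] over [S].  If the
   neighbors are discovered by independent exponential clocks of rates [p j],
   conditioning on the first discovery gives, for the expected times [T],
   [sigma(N) T(N) = 1 + \sum_(j in N) p j T(N \ j)];
   algebraically this is the identity [\sum_(S \subset N) (-1)^|S| = 0].
   The bound then follows by induction on [n = #|N|] from Nesbitt's inequality
   [\sum_(j in N) p j / (sigma(N) - p j) >= n / (n - 1)]. *)
Require Import Defs.
From mathcomp Require Import all_boot all_order all_algebra.
From mathcomp Require Import ring lra.

Import Order.TTheory GRing.Theory Num.Theory.
Local Open Scope ring_scope.

(** Toggling membership of a fixed [j] in [N] pairs the subsets with opposite signs. *)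
Lemma sum_sign_subsets (R : pzRingType) (V : finType) (N : {set V}) :
  N != set0 -> \sum_(S : {set V} | S \subset N) (-1) ^+ #|S| = 0 :> R.
Proof.
case/set0Pn=> j jN.
rewrite (bigID (fun S : {set V} => j \in S)) /=.
rewrite (reindex_onto (fun S => j |: S) (fun S => S :\ j)) /=; last first.
  by move=> S /andP[_ jS]; rewrite setD1K.
rewrite -[RHS](addNr (\sum_(S : {set V} | (S \subset N) && (j \notin S))
  (-1) ^+ #|S|)); congr (_ + _).
rewrite -sumrN; apply: eq_big => [S|S /andP[_ /eqP SE]].
  rewrite setU11 andbT subUset sub1set jN; congr (_ && _).
  by apply/eqP/idP => [<-|/setU1K//]; rewrite !inE eqxx.
have jS : j \notin S by rewrite -SE !inE eqxx.
by rewrite cardsU1 jS exprS mulN1r.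
Qed.

Lemma sum_gt0 (R : realFieldType) (V : finType) (f : V -> R) (S : {set V}) :
  S != set0 -> (forall j, j \in S -> 0 < f j) -> 0 < \sum_(j in S) f j.
Proof.
case/set0Pn=> k kS f_gt0; rewrite (bigD1 k) //= ltr_pwDl ?f_gt0 // sumr_ge0 //.
by move=> j /andP[jS _]; rewrite ltW ?f_gt0.
Qed.

(** Once the sums are exchanged, a nonempty [S] has weight [sigma(N)] on the left and [sigma(N \ S)]
    on the right; the difference [sigma(S)] cancels the denominator and leaves only a sign. *)
Lemma expected_discovery_time_rec (R : realFieldType) (V : finType)
    (P : V -> V -> R) (i : V) (N : {set V}) :
  N != set0 -> (forall j, j \in N -> 0 < P j i) ->
  (\sum_(j in N) P j i) * expected_discovery_time P i N =
    1 + \sum_(j in N) P j i * expected_discovery_time P i (N :\ j).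
Proof.
move=> N0 P_gt0; apply/eqP; rewrite -subr_eq; apply/eqP.
have -> : \sum_(j in N) P j i * expected_discovery_time P i (N :\ j) =
  \sum_(S : {set V} | (S != set0) && (S \subset N))
    (\sum_(j in N :\: S) P j i) *
    ((-1) ^+ (#|S|.+1) * (1 / \sum_(j in S) P j i)).
  under eq_bigr do rewrite mulr_sumr.
  rewrite (exchange_big_dep (fun S => (S != set0) && (S \subset N))) /=.
    apply: eq_bigr => S /andP[S0 SN]; rewrite mulr_suml.
    by apply: eq_bigl => j; rewrite !inE S0 subsetD1 SN andbC.
  by move=> j S _; rewrite subsetD1 => /and3P[-> ->].
rewrite mulr_sumr -sumrB.
(* The empty set contributes 1 to the vanishing signed sum; this is the 1 of the recursion. *)
have := sum_sign_subsets R V N N0.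
rewrite (bigD1 set0) ?sub0set //= cards0 expr0 => /eqP.
rewrite addr_eq0 => /eqP sum1; rewrite [RHS]sum1 -sumrN.
apply: eq_big => [S|S /andP[S0 SN]]; first by rewrite andbC.
have s_gt0 : 0 < \sum_(j in S) P j i.
  by apply: sum_gt0 => // j /(subsetP SN); exact: P_gt0.
rewrite -mulrBl (big_setID S) /= (setIidPr SN) addrK exprS.
by rewrite mulrCA div1r mulfV ?gt_eqF // mulr1 mulN1r.
Qed.

(* The right-hand side is the tangent line at [p = s / (m + 1)]. *)
Lemma nesbitt_tangent (R : realFieldType) (m p s : R) :
  0 < m -> 0 < s -> p < s ->
  m * (p / (s - p)) >= 1 + (m + 1) ^+ 2 / m * (p / s - (m + 1)^-1).
Proof.
move=> m_gt0 s_gt0 ps; rewrite -subr_ge0.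
have -> : m * (p / (s - p)) -
    (1 + (m + 1) ^+ 2 / m * (p / s - (m + 1)^-1)) =
  ((m + 1) * p - s) ^+ 2 / (m * s * (s - p)).
  by field; rewrite !gt_eqF //; lra.
by rewrite divr_ge0 ?sqr_ge0 // !mulr_ge0 //; lra.
Qed.

(** With [n = m.+2], the tangent bound is taken at the mean [s / n], the equality case of Nesbitt's
    inequality. *)
Lemma nesbitt (R : realFieldType) (V : finType) (f : V -> R) (N : {set V}) m :
  #|N| = m.+2 -> (forall j, j \in N -> 0 < f j) ->
  m.+2%:R <= m.+1%:R * \sum_(j in N) f j / (\sum_(k in N) f k - f j).
Proof.
move=> cN f_gt0; set s := \sum_(k in N) f k.
(* Strictness comes from a second element of [N]. *)
have f_lt j : j \in N -> f j < s.
  move=> jN; rewrite /s (big_setD1 j) //= ltrDl; apply: sum_gt0 => [|k].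
    by rewrite -card_gt0; move: cN; rewrite (cardsD1 j) jN add1n => -[->].
  by rewrite inE => /andP[_ /f_gt0].
have s_gt0 : 0 < s.
  by apply: sum_gt0 f_gt0; rewrite -card_gt0 cN.
rewrite mulr_sumr.
apply: le_trans (ler_sum _ (fun j jN =>
  nesbitt_tangent R m.+1%:R (f j) s (ltr0Sn _ _) s_gt0 (f_lt j jN))).
(* The slope terms cancel: the ratios [f j / s] add up to 1, and so do [n] copies of [1 / n]. *)
rewrite big_split /= -mulr_sumr sumrB -mulr_suml !sumr_const cN.
rewrite divff ?gt_eqF // -natr1 natr1 -[_^-1 *+ _]mulr_natr mulVf ?pnatr_eq0 //.
by rewrite subrr mulr0 addr0.
Qed.

Lemma harmonic_numberS (R : realFieldType) n :
  harmonic_number R n.+1 = harmonic_number R n + n.+1%:R^-1.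
Proof. by rewrite /harmonic_number big_nat_recr //= div1r. Qed.

Lemma harmonic_number_ge0 (R : realFieldType) n : 0 <= harmonic_number R n.
Proof. by apply: sumr_ge0 => m _; rewrite divr_ge0. Qed.

(** Allowing an empty [N], where both sides are 0, lets the induction pass from [N] to [N \ j] even
    for a single neighbor. *)
Lemma expected_discovery_time_ge (R : realFieldType) (V : finType)
    (P : V -> V -> R) (i : V) (N : {set V}) :
  (forall j, j \in N -> 0 < P j i) ->
  #|N|%:R * harmonic_number R #|N| / (\sum_(j in N) P j i) <=
    expected_discovery_time P i N.
Proof.
have [n] := ubnP #|N|; elim: n N => // n IHn N; rewrite ltnS => leNn P_gt0.
have [->|N0] := eqVneq N set0.
  rewrite cards0 !mul0r /expected_discovery_time big1 // => S /andP[/negPf S0].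
  by rewrite subset0 S0.
have s_gt0 := sum_gt0 R V (P^~ i) N N0 P_gt0.
rewrite ler_pdivrMr // [leRHS]mulrC expected_discovery_time_rec //.
case cN: #|N| => [|m]; first by move: N0; rewrite -card_gt0 cN.
have cD j : j \in N -> #|N :\ j| = m.
  by move=> jN; move: cN; rewrite (cardsD1 j) jN add1n => -[].
(* Since [n H_n = 1 + n H_(n-1)], the 1 cancels against that of the recursion. *)
rewrite harmonic_numberS mulrDr mulfV ?pnatr_eq0 // addrC lerD2l.
apply: (@le_trans _ _ (\sum_(j in N) P j i *
  (m%:R * harmonic_number R m / (\sum_(k in N) P k i - P j i)))); last first.
  apply: ler_sum => j jN; rewrite ler_pM2l ?P_gt0 //.
  have := IHn (N :\ j); rewrite cD // (big_setD1 j jN) /= addrC addrK; apply.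
    by rewrite -ltnS -cN.
  by move=> k; rewrite inE => /andP[_ /P_gt0].
(* For [n = 1] both sides are 0, as [H_0 = 0]; from [n = 2] on, Nesbitt's inequality is multiplied
   by [H_(n-1)]. *)
case: m cN {cD} => [|m] cN.
  rewrite /harmonic_number big_geq // mulr0.
  by rewrite big1 // => j _; rewrite !mul0r mulr0.
under eq_bigr do rewrite mulrCA.
rewrite -mulr_sumr.
have := ler_wpM2r (harmonic_number_ge0 R m.+1)
  (nesbitt R V (P^~ i) N m cN P_gt0).
by rewrite [leRHS]mulrAC.
Qed.

Theorem theorem1 (R : realFieldType) (V : finType) (i : V) (N : {set V})
    (P : V -> V -> R)
    (hN : N != set0)
    (hP : forall j : V, j \in N -> 0 < P j i /\ P j i <= 1) :
  expected_discovery_time P i N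
    >= harmonic_number R #|N| / mean_discovery_prob P i N.
Proof.
have := expected_discovery_time_ge R V P i N (fun j jN => (hP j jN).1).
rewrite /mean_discovery_prob div1r invfM invrK mulrA.
by rewrite [harmonic_number _ _ * _]mulrC.
Qed.
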